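(* Let $G$ be a finite, simple, connected, undirected graph. Then $G$ is a quasi-line graph if and only if for every integer $n \ge 1$, $G$ does not have $K_1 + C_{2n+1}^{C}$ as an induced subgraph.
   Context: A graph $G$ is a quasi-line graph if for every vertex $v$, the set $N(v)$ of neighbours of $v$ is expressible as the union of two cliques, i.e. $N(v) = Q_1 \cup Q_2$ where $Q_1$ and $Q_2$ each induce a complete subgraph of $G$ (not necessarily disjoint, possibly empty). $C_k$ denotes the cycle on $k$ vertices, and $H^{C}$ denotes the complement of a graph $H$. $K_1 + H$ denotes the join of a single vertex with $H$: the graph obtained from $H$ by adding one new vertex adjacent to every vertex of $H$. ''$G$ has $H$ as an induced subgraph'' means that some subset of $V(G)$ induces a subgraph isomorphic to $H$. *)

(* Defs.v *)
From HB Require Import structures.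
From mathcomp Require Import all_boot.
Set Implicit Arguments.
Unset Strict Implicit.
Unset Printing Implicit Defensive.

(* The vertex set may be empty. *)
Record sgraph := SGraph {
  vertex :> finType;
  adj : rel vertex;
  adj_sym : symmetric adj;
  adj_irr : irreflexive adj }.

Arguments adj {s}.

Definition connected_graph (G : sgraph) : Prop :=
  forall x y : G, connect adj x y.

Definition neighbours (G : sgraph) (v : G) : {set G} := [set x | adj v x].

Definition clique (G : sgraph) (Q : {set G}) : Prop :=
  {in Q &, forall x y, x != y -> adj x y}.

Definition quasi_line (G : sgraph) : Prop :=
  forall v : G, exists Q1 Q2 : {set G},
    [/\ clique Q1, clique Q2 & neighbours v = Q1 :|: Q2].

Definition isomorphic (G H : sgraph) : Prop :=
  exists2 f : G -> H, bijective f & {mono f : x y / adj x y}.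

Section Induced.
Variables (G : sgraph) (A : {set G}).
Definition induced_adj : rel {x : G | x \in A} :=
  [rel x y | adj (val x) (val y)].
Fact induced_sym : symmetric induced_adj.
Proof. by move=> x y; apply: adj_sym. Qed.
Fact induced_irr : irreflexive induced_adj.
Proof. by move=> x; apply: adj_irr. Qed.
Definition induced : sgraph := SGraph induced_sym induced_irr.
End Induced.

Definition has_induced_subgraph (G H : sgraph) : Prop :=
  exists A : {set G}, isomorphic (induced A) H.

Section Complement.
Variable G : sgraph.
Definition compl_adj : rel G := [rel x y | (x != y) && ~~ adj x y].
Fact compl_sym : symmetric compl_adj.
Proof. by move=> x y; rewrite /compl_adj /= eq_sym adj_sym. Qed.
Fact compl_irr : irreflexive compl_adj.
Proof. by move=> x; apply/negbTE; rewrite negb_and eqxx. Qed.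
Definition complement : sgraph := SGraph compl_sym compl_irr.
End Complement.

(* K_1 + H, where None is the new vertex. *)
Section Cone.
Variable H : sgraph.
Definition cone_adj : rel (option H) := fun x y =>
  match x, y with
  | Some a, Some b => adj a b
  | None, None => false
  | _, _ => true
  end.
Fact cone_sym : symmetric cone_adj.
Proof. by case=> [a|] [b|] //; apply: adj_sym. Qed.
Fact cone_irr : irreflexive cone_adj.
Proof. by case=> [a|] //; apply: adj_irr. Qed.
Definition K1_join : sgraph := SGraph cone_sym cone_irr.
End Cone.

(* The cycle C_k on {0, ..., k-1}; ordS is the successor modulo k. The name
   is meaningful for k >= 3; the test i != j only matters for k = 1. *)
Section Cycle.
Variable k : nat.
Definition cycle_adj : rel 'I_k :=
  [rel i j | (i != j) && ((j == ordS i) || (i == ordS j))].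
Fact cycle_sym : symmetric cycle_adj.
Proof. by move=> i j; rewrite /cycle_adj /= eq_sym orbC. Qed.
Fact cycle_irr : irreflexive cycle_adj.
Proof. by move=> i; apply/negbTE; rewrite negb_and eqxx. Qed.
Definition cycle_graph : sgraph := SGraph cycle_sym cycle_irr.
End Cycle.

(* Main.v *)
Require Import Defs.
From HB Require Import structures.
From mathcomp Require Import all_boot zify.
Set Implicit Arguments.
Unset Strict Implicit.
Unset Printing Implicit Defensive.

(** Two vertices of [N(v)] cannot lie in the same clique when they are distinct
    and non-adjacent.  So [N(v)] is a union of two cliques exactly when the
    non-adjacency graph on [N(v)], the complement of the graph induced by
    [N(v)], is 2-colourable, and quasi-line graphs are those for which this
    holds at every vertex [v].

    By the classical theorem on bipartite graphs, a graph is 2-colourable if and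
    only if it has no odd closed walk ([odd_cycle_free_colouring]).  If there is
    an odd closed walk, a shortest one is an induced odd cycle: a repeated vertex
    or a chord would split it into two closed walks, one of which is odd and
    shorter ([min_odd_cycle_uniq], [min_odd_cycle_chordless]).  So excluding
    induced odd cycles is enough ([induced_odd_cycle_free_colouring]), and
    conversely an odd cycle has no 2-colouring ([odd_cycle_not_alternating]).
    Hence 2-colouring fails at [v] exactly when the non-adjacency graph on [N(v)]
    contains an induced [C_(2n+1)], that is, when [v] together with the vertices
    of that cycle induces the join of [K_1] with the complement of [C_(2n+1)].
    The case [n = 1] is the claw. *)

(** The sum modulo 2 of the colours is invariant under the rotation of the
    cycle, but flipping all [k] colours changes it by [k] modulo 2. *)
Lemma odd_cycle_not_alternating k (c : 'I_k -> bool) :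
  odd k -> ~ (forall i, c (ordS i) = ~~ c i).
Proof.
move=> odd_k alt_c; set S := \big[addb/false]_i c i.
suff: S = odd k (+) S by rewrite odd_k; case: S.
rewrite {1}/S (reindex (@ordS k)) /=; last exact/onW_bij/ordS_bij.
under eq_bigr do rewrite alt_c -addTb.
rewrite big_split /=; congr (_ (+) _).
by rewrite big_const card_ord; elim: k {c odd_k alt_c S} => //= k ->.
Qed.

Lemma neq_ordS k (i : 'I_k) : 1 < k -> i != ordS i.
Proof.
move=> k_gt1; rewrite -val_eqE /=; have := ltn_ord i.
rewrite leq_eqVlt => /predU1P[def_k|lt_iSk]; last by rewrite modn_small //; lia.
by rewrite def_k modnn; lia.
Qed.

Lemma nth_next (T : eqType) (x0 : T) s i :
  uniq s -> i < size s -> next s (nth x0 s i) = nth x0 s (i.+1 %% size s).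
Proof.
move=> us lt_is; rewrite next_nth mem_nth // index_uniq //.
case: s us lt_is => // y s _; rewrite leq_eqVlt => /predU1P[[->]|lt_iSs].
  by rewrite modnn nth_default.
by rewrite modn_small //=; exact: set_nth_default.
Qed.

Section OddCycles.
Variables (T : finType) (e : rel T).
Hypothesis e_sym : symmetric e.

(** In each connected component, colour a vertex by the parity of a chosen walk
    from the root of the component.  An edge between two vertices of the same
    colour, together with their walks from the root, would be an odd closed
    walk. *)
Lemma odd_cycle_free_colouring :
  (forall s, cycle e s -> ~~ odd (size s)) ->
  exists c : T -> bool, forall x y, e x y -> c x != c y.
Proof.
move=> no_odd.
have csym : connect_sym e by exact: sym_connect_sym.
have walk x : exists p, path e (root e x) p && (last (root e x) p == x).
  have /connectP[p ep lp] : connect e (root e x) x.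
    by rewrite csym connect_root.
  by exists p; rewrite ep -lp eqxx.
exists (fun x => odd (size (xchoose (walk x)))) => x y exy.
have /andP[] := xchooseP (walk x); have /andP[] := xchooseP (walk y).
move: (xchoose (walk x)) (xchoose (walk y)) => p q.
have -> : root e y = root e x.
  by apply/esym/eqP; rewrite root_connect ?connect1.
set r := root e x => eq /eqP lq ep /eqP lp.
(* The closed walk runs from r along p to x, then to y, and back along q. *)
have /no_odd : cycle e (rcons (belast r q) y ++ rev p).
  rewrite -{1}lq -lastI /= rcons_cat -rev_cons cat_path eq lastI rev_rcons /=.
  rewrite lq lp e_sym exy -{1}lp rev_path.
  by under eq_path do rewrite e_sym.
rewrite size_cat size_rcons size_belast size_rev /= oddD.
by case: (odd (size p)); case: (odd (size q)).
Qed.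

Hypothesis e_irr : irreflexive e.

Section Shortest.
Variable s : seq T.
Hypotheses (es : cycle e s) (odd_s : odd (size s)).
Hypothesis s_min :
  forall t, cycle e t -> odd (size t) -> size s <= size t.

(** A repeated vertex splits the closed walk into two shorter ones whose lengths
    add up to the odd number [size s]. *)
Lemma min_odd_cycle_uniq : uniq s.
Proof.
apply: count_mem_uniq => x.
have [/rot_to[i s' def_s]|/count_memPn-> //] := boolP (x \in s).
have es' : cycle e (x :: s') by rewrite -def_s rot_cycle.
have size_s : size s = (size s').+1 by rewrite -(size_rot i) def_s.
rewrite -(permP (permEl (perm_rot i s))) def_s /= eqxx.
suff /count_memPn-> : x \notin s' by [].
apply/negP => /path.splitPr def_s'.
case: s' / def_s' es' size_s {def_s} => p1 p2.
rewrite size_cat /= rcons_cat /= cat_path /= => /and3P[ep1 ex ep2] size_s.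
have := s_min (t := x :: p1); have := s_min (t := x :: p2).
rewrite /= !rcons_path; rewrite rcons_path in ep2; rewrite ep1 ex ep2.
by move=> /(_ isT) + /(_ isT); lia.
Qed.

(** A chord [x y] splits the closed walk into two closed walks that both use the
    chord, so their lengths add up to the odd number [size s + 2].  The odd one
    is not shorter than [s], hence the other one consists of [x] and [y] only:
    they are consecutive in [s]. *)
Lemma min_odd_cycle_chordless :
  {in s &, forall x y, e x y = (y == next s x) || (x == next s y)}.
Proof.
move=> x y xs ys; apply/idP/idP => [exy|]; last first.
  by case/orP=> /eqP->; [|rewrite e_sym]; exact: next_cycle.
have [i s' def_s] := rot_to xs.
have es' : cycle e (x :: s') by rewrite -def_s rot_cycle.
have size_s : size s = (size s').+1 by rewrite -(size_rot i) def_s.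
have us := min_odd_cycle_uniq.
have us' : uniq (x :: s') by rewrite -def_s rot_uniq.
rewrite -!(next_rot i us) def_s.
have ys' : y \in s'.
  have: y \in x :: s' by rewrite -def_s mem_rot.
  by rewrite inE; case: eqP exy => // ->; rewrite e_irr.
case/path.splitPr: s' / ys' es' us' size_s {def_s} => p1 p2 es' us' size_s.
have /and3P[ep1 ey ep2] :
    [&& path e x p1, e (last x p1) y & path e y (rcons p2 x)].
  by move: es'; rewrite /= rcons_cat cat_path.
rewrite /= size_cat /= in size_s.
have min1 := s_min (t := x :: rcons p1 y).
have min2 := s_min (t := [:: x, y & p2]).
rewrite /= !rcons_path ep1 ey last_rcons e_sym exy size_rcons in min1.
rewrite /= exy ep2 in min2.
have [p1_nil|p2_nil] : size p1 = 0 \/ size p2 = 0.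
- move: (min1 isT) (min2 isT) (odd_s); rewrite size_s /= !negbK oddD /=.
  case: (odd (size p1)); case: (odd (size p2)) => //=.
    by move=> /(_ isT) le_p1 _ _; right; lia.
  by move=> _ /(_ isT) le_p2 _; left; lia.
- by rewrite (size0nil p1_nil) /= eqxx eqxx.
move: us'; rewrite (size0nil p2_nil) => us'.
suff -> : next (x :: p1 ++ [:: y]) y = x by rewrite eqxx orbT.
move: us'; rewrite cats1 -rcons_cons -rot1_cons rot_uniq => us'.
by rewrite (next_rot 1 us') /= eqxx.
Qed.

End Shortest.

(** By strong induction on the length, every closed walk is even: once the
    shorter ones are known to be even, an odd closed walk is a shortest one, so
    its vertices, taken in order, form an induced odd cycle. *)
Theorem induced_odd_cycle_free_colouring :
  (forall k (g : 'I_k -> T), 2 < k -> odd k -> injective g ->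
     ~ {mono g : i j / cycle_adj i j >-> e i j}) ->
  exists c : T -> bool, forall x y, e x y -> c x != c y.
Proof.
move=> no_induced; apply: odd_cycle_free_colouring => s.
have [m] := ubnP (size s); elim: m s => // m IHm s lt_s_m es.
apply/negP => odd_s.
have s_min t : cycle e t -> odd (size t) -> size s <= size t.
  move=> et odd_t; rewrite leqNgt; apply/negP => lt_ts.
  by have /negP[] := IHm t (leq_trans lt_ts lt_s_m) et.
have us := min_odd_cycle_uniq es odd_s s_min.
have size_s : 2 < size s.
  case: s es odd_s {IHm lt_s_m s_min us} => [|x [|y [|z s]]] //=.
  by rewrite e_irr.
have [x0 _] : exists x0, x0 \in s.
  by case: s size_s {es odd_s s_min us lt_s_m} => // x; exists x; exact: mem_head.
pose g (i : 'I_(size s)) := nth x0 s i.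
have g_inj : injective g.
  by move=> i j /eqP; rewrite nth_uniq // => /eqP/val_inj.
have gS i : g (ordS i) = next s (g i) by rewrite nth_next.
apply: (no_induced _ g) => // i j.
rewrite (min_odd_cycle_chordless es odd_s s_min) ?mem_nth // -!gS.
rewrite !(inj_eq g_inj) /cycle_adj /=.
by case: (i =P j) => //= <-; rewrite orbb; apply/negbTE/neq_ordS/ltnW.
Qed.

End OddCycles.

Lemma embedding_induced_subgraph (G H : sgraph) (h : H -> G) :
  injective h -> {mono h : x y / adj x y} -> has_induced_subgraph G H.
Proof.
move=> h_inj h_mono; exists (h @: [set: H]).
pose k x : induced (h @: [set: H]) := exist _ (h x) (imset_f h (in_setT x)).
have k_inj : injective k by move=> x y [/h_inj].
have [|f kf fk] := inj_card_bij k_inj.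
  by rewrite card_sig card_imset // cardsT.
exists f; first by exists k.
by move=> u v; rewrite -{2}(fk u) -{2}(fk v); exact/esym/h_mono.
Qed.

Lemma induced_subgraph_embedding (G H : sgraph) :
  has_induced_subgraph G H ->
  exists2 h : H -> G, injective h & {mono h : x y / adj x y}.
Proof.
case=> A [f [k fk kf] f_mono]; exists (val \o k).
  exact: inj_comp val_inj (can_inj kf).
by move=> x y; rewrite -{2}(kf x) -{2}(kf y) f_mono.
Qed.

(** Distinct non-adjacent neighbours lie in different cliques, so membership in
    [Q1] would be a 2-colouring of the odd cycle. *)
Lemma quasi_line_no_cone (G : sgraph) k :
  2 < k -> odd k -> quasi_line G ->
  ~ has_induced_subgraph G (K1_join (complement (cycle_graph k))).
Proof.
move=> k_gt2 odd_k qlG /induced_subgraph_embedding[h h_inj h_mono].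
have [Q1 [Q2 [clQ1 clQ2 defN]]] := qlG (h None).
pose g (i : 'I_k) := h (Some i).
have gN i : (g i \in Q1) || (g i \in Q2).
  by rewrite -in_setU -defN inE (h_mono None (Some i)).
apply: (odd_cycle_not_alternating (c := fun i => g i \in Q1) odd_k) => i.
have neq_iS : i != ordS i by apply: neq_ordS; lia.
have neq_g : g i != g (ordS i) by rewrite (inj_eq h_inj).
have nadj : ~~ adj (g i) (g (ordS i)).
  rewrite (h_mono (Some i) (Some (ordS i))) /= /compl_adj /=.
  by rewrite /cycle_adj /= neq_iS eqxx.
case: (boolP (g i \in Q1)) (gN i) => /= [iQ1 _|_ iQ2].
  by apply/negP => SQ1; rewrite clQ1 in nadj.
by case/orP: (gN (ordS i)) => // SQ2; rewrite clQ2 in nadj.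
Qed.

(** The relation to colour is non-adjacency on [N(v)]; the two colour classes of
    [N(v)] are the cliques. *)
Lemma no_cone_quasi_line (G : sgraph) :
  (forall k, 2 < k -> odd k ->
     ~ has_induced_subgraph G (K1_join (complement (cycle_graph k)))) ->
  quasi_line G.
Proof.
move=> no_cone v; pose N := neighbours v.
pose e : rel G := [rel x y | [&& x \in N, y \in N, x != y & ~~ adj x y]].
have e_sym : symmetric e.
  by move=> x y; rewrite /e /= andbCA eq_sym adj_sym.
have e_irr : irreflexive e by move=> x; rewrite /e /= eqxx !andbF.
have [|c cP] := induced_odd_cycle_free_colouring e_sym e_irr; last first.
  have cl b : clique [set x in N | c x == b].
    move=> x y; rewrite !inE => /andP[xN /eqP cx] /andP[yN /eqP cy] neq_xy.
    apply: contraTT (eqxx b) => nadj; rewrite -{1}cx -cy.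
    by apply: cP; rewrite /e /= !inE xN yN neq_xy.
  exists [set x in N | c x == true], [set x in N | c x == false].
  split=> //; apply/setP=> x; rewrite !inE.
  by case: (c x); rewrite ?andbT ?andbF ?orbF.
move=> k g k_gt2 odd_k g_inj g_mono; apply: (no_cone k k_gt2 odd_k).
(* Non-adjacency relates only neighbours of v, and every vertex of the cycle is
   related to its successor. *)
have gN i : adj v (g i).
  have /and3P[] : e (g i) (g (ordS i)).
    by rewrite g_mono /cycle_adj /= eqxx neq_ordS // ltnW.
  by rewrite inE.
pose h (a : option 'I_k) := if a is Some i then g i else v.
refine (@embedding_induced_subgraph
  G (K1_join (complement (cycle_graph k))) h _ _).
  case=> [i|] [j|] //= E.
  - by rewrite (g_inj _ _ E).
  - by have := gN i; rewrite E adj_irr.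
  - by have := gN j; rewrite -E adj_irr.
case=> [i|] [j|] //=; rewrite ?adj_irr ?gN //; last by rewrite adj_sym gN.
have := g_mono i j; rewrite /compl_adj /= => <-.
rewrite /e /= !inE !gN (inj_eq g_inj) /=.
by case: eqP => [->|_] /=; rewrite ?adj_irr // negbK.
Qed.

Theorem corollary1 (G : sgraph) (hG : connected_graph G) :
  quasi_line G <->
  (forall n : nat, 1 <= n ->
     ~ has_induced_subgraph G (K1_join (complement (cycle_graph (2 * n + 1))))).
Proof.
split=> [qlG n n_gt0|no_cone]; first by apply: quasi_line_no_cone qlG; lia.
apply: no_cone_quasi_line => k k_gt2 odd_k.
have -> : k = 2 * k./2 + 1 by lia.
by apply: no_cone; lia.
Qed.
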